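(* Let $H$ be a locally finitely generated monoid. Then $H$ is asymptotic fully elastic, i.e. for every rational number $q$ with $\inf \overline{R}(H) < q < \rho(H)$ there is an $a \in H\setminus H^{\times}$ such that $\overline{\rho}(a)=q$. Moreover, if $\inf \overline{R}(H)=1$, then $H$ is fully elastic, i.e. for every rational number $q$ with $1<q<\rho(H)$ there is an $L\in\mathcal L(H)$ with $\rho(L)=q$.
   Context: A monoid is a commutative cancellative semigroup with identity, written multiplicatively. $H^{\times}$ is the unit group of $H$ and $H_{\mathrm{red}}=H/H^{\times}=\{aH^{\times}\mid a\in H\}$ is the associated reduced monoid. For $a\in H$, $[\![a]\!]=\{b\in H\mid b \text{ divides } a^n \text{ in } H \text{ for some } n\in\mathbb N\}$ is the smallest divisor-closed submonoid of $H$ containing $a$. $H$ is locally finitely generated if for every $a\in H$ the monoid $[\![a]\!]_{\mathrm{red}}$ is finitely generated (equivalently, up to associates only finitely many atoms divide some power of $a$). An atom is a non-unit $u$ such that $u=ab$ with $a,b\in H$ implies $a\in H^\times$ or $b\in H^\times$. For a non-unit $a$, $\mathsf L(a)\subset\mathbb N$ is the set of all $k$ such that $a=u_1\cdots u_k$ with atoms $u_i$; for a unit $a$, $\mathsf L(a)=\{0\}$. $\mathcal L(H)=\{\mathsf L(a)\mid a\in H\}$. $H$ is a BF-monoid if every non-unit is a product of atoms and all $\mathsf L(a)$ are finite; locally finitely generated monoids are BF-monoids. For a finite set $L\subset \mathbb N$, $\rho(L)=\max L/\min L$, and $\rho(\{0\})=1$; $\rho(a)=\rho(\mathsf L(a))$;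 $\rho(H)=\sup\{\rho(L)\mid L\in\mathcal L(H)\}\in\mathbb R_{\ge1}\cup\{\infty\}$. For $a\in H\setminus H^\times$, the asymptotic elasticity is $\overline\rho(a)=\lim_{n\to\infty}\rho(a^n)$ (the limit exists), and $\overline R(H)=\{\overline\rho(a)\mid a\in H\setminus H^{\times}\}\subset \mathbb R_{\ge 1}\cup\{\infty\}$. *)

(* Defs.v *)
From mathcomp Require Import all_boot all_order all_algebra.
From mathcomp Require Import all_classical all_reals all_analysis.

Set Implicit Arguments.
Unset Strict Implicit.
Unset Printing Implicit Defensive.

Import Order.TTheory GRing.Theory Num.Theory.
Import numFieldNormedType.Exports.

Local Open Scope classical_set_scope.

(* Monoids are written multiplicatively in [group_scope]. Commutativity and
   cancellativity are hypotheses of the statement and are not needed by the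
   definitions. *)

Definition mon_commutative (H : monoidType) : Prop :=
  forall a b : H, (a * b = b * a)%g.

Definition mon_cancellative (H : monoidType) : Prop :=
  forall a b c : H, (a * b = a * c)%g -> b = c.

Definition mon_dvd (H : monoidType) (b c : H) : Prop :=
  exists d : H, (c = b * d)%g.

(* Unit group of a submonoid [S]; the unit group of [H] is [units setT]. *)
Definition units (H : monoidType) (S : set H) : set H :=
  [set u | S u /\ exists2 v : H, S v & (u * v = 1)%g].

Definition is_unit (H : monoidType) (a : H) : Prop := units [set: H] a.

Definition unit_coset (H : monoidType) (S : set H) (a : H) : set H :=
  [set (a * u)%g | u in units S].

(* The reduced monoid of a submonoid [S], with carrier the cosets a S^x. Its
   product is the product of subsets [set_mul], its identity is [units S]. *)
Definition reduced (H : monoidType) (S : set H) : set (set H) :=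
  [set unit_coset S a | a in S].

Definition set_mul (H : monoidType) (A B : set H) : set H :=
  [set (x * y)%g | x in A & y in B].

Definition reduced_finitely_generated (H : monoidType) (S : set H) : Prop :=
  exists E : set (set H), [/\ finite_set E, E `<=` reduced S &
    forall A : set H, reduced S A ->
      exists2 s : seq (set H), (forall B : set H, B \in s -> E B) &
        A = \big[@set_mul H/units S]_(B <- s) B].

Definition divisor_closure (H : monoidType) (a : H) : set H :=
  [set b | exists2 n : nat, (0 < n)%N & mon_dvd b (a ^+ n)%g].

Definition locally_finitely_generated (H : monoidType) : Prop :=
  forall a : H, reduced_finitely_generated (divisor_closure a).

Definition atom (H : monoidType) (u : H) : Prop :=
  ~ is_unit u /\
  forall a b : H, (u = a * b)%g -> is_unit a \/ is_unit b.

Definition lengths (H : monoidType) (a : H) : set nat :=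
  [set k | (is_unit a /\ k = 0%N) \/
           (~ is_unit a /\ exists s : seq H,
              [/\ size s = k, forall u : H, u \in s -> atom u &
                  a = (\prod_(u <- s) u)%g])].

Definition length_system (H : monoidType) : set (set nat) :=
  [set lengths a | a in [set: H]].
Arguments length_system : clear implicits.

(* Meaningful for nonempty finite sets; the value is 0 if there is no
   maximum. *)
Definition set_max (L : set nat) : nat :=
  xget 0%N [set m | L m /\ forall k : nat, L k -> (k <= m)%N].

Definition set_min (L : set nat) : nat :=
  xget 0%N [set m | L m /\ forall k : nat, L k -> (m <= k)%N].

(* Only applied to nonempty finite sets of lengths, since locally finitely
   generated monoids are BF-monoids. *)
Definition elasticity (R : realType) (L : set nat) : R :=
  if `[< L = [set 0%N] >] then 1%R
  else ((set_max L)%:R / (set_min L)%:R)%R.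

Definition mon_elasticity (R : realType) (H : monoidType) : \bar R :=
  ereal_sup [set (elasticity R L)%:E | L in length_system H].

Definition asymptotic_elasticity (R : realType) (H : monoidType) (a : H)
    : \bar R :=
  limn (fun n : nat => (elasticity R (lengths (a ^+ n)%g))%:E).

Definition asymptotic_elasticities (R : realType) (H : monoidType)
    : set (\bar R) :=
  [set asymptotic_elasticity R a | a in [set a : H | ~ is_unit a]].
Arguments asymptotic_elasticities : clear implicits.

Definition asymptotic_fully_elastic (R : realType) (H : monoidType) : Prop :=
  forall q : rat,
    (ereal_inf (asymptotic_elasticities R H) < (ratr q)%:E)%E ->
    ((ratr q)%:E < mon_elasticity R H)%E ->
    exists2 a : H, ~ is_unit a & asymptotic_elasticity R a = (ratr q)%:E.

Definition fully_elastic (R : realType) (H : monoidType) : Prop :=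
  forall q : rat, (1 < q)%R -> ((ratr q)%:E < mon_elasticity R H)%E ->
    exists2 L : set nat, length_system H L & elasticity R L = ratr q.

(* Main.v *)
Require Import Defs.
From HB Require Import structures.
From mathcomp Require Import all_boot all_order all_algebra.
From mathcomp Require Import all_classical all_reals all_analysis.
From mathcomp Require Import zify ring.

(** Write c(i, j) = a^i b^j, and let L(c) be the set of lengths of c.

    The triples (l, i, j) with l in L(c(i, j)) form a submonoid of N^3, since
    lengths add under multiplication. Local finite generation makes this
    submonoid finitely generated: up to associates only finitely many atoms
    divide some power of ab, so factorizations are vectors over a finite set of
    atoms, Dickson's lemma leaves finitely many minimal ones, and cancellativity
    allows a minimal one to be split off from any other. Hence a linear
    inequality between l, i and j holds on the whole submonoid as soon as it
    holds on a finite set G of triples ([lengths_cone]).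

    For a = b this says that max L(c^n) and min L(c^n) are governed by the
    largest and the smallest slope l / (i + j) of a triple in G. Both slopes are
    attained after passing to a power: every non-unit c has a power c^N which is
    [sharp], meaning that max L(c^(N n)) = M n and min L(c^(N n)) = m n for all
    n ([sharp_power]). Consequently the asymptotic elasticity of c is M / m, it
    is an upper bound for the elasticities of the powers of c, and c^N itself
    has elasticity exactly M / m ([asymptotic_elasticityE], [elasticity_sharp]).

    Given inf R(H) < q < rho(H), choose sharp elements a and b whose ratios lie
    strictly below and strictly above q. On the directions (i, j) of the
    quadrant, the asymptotic maximal length per power of c(i, j) is concave and
    the asymptotic minimal length is convex, and both are linear on any cone
    containing no direction of G in its interior: a concave function lies below
    a secant line outside the chord, so the inequality given by the secant holds
    at every triple of G and therefore everywhere ([sharp_interior]). Start with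
    the cone spanned by a and b. If a direction of G lies strictly inside, then
    either its ratio is q, or it can replace one of the two boundary rays so
    that the ratios on the boundary still enclose q, and fewer directions of G
    lie inside the new cone. If none lies inside, then max - q min is linear on
    the cone with rational coefficients and changes sign, so it vanishes in a
    rational direction ([sharp_ratio]). The sharp element found there has both
    asymptotic elasticity and elasticity equal to q, which gives the two parts
    of the theorem. *)

Set Implicit Arguments.
Unset Strict Implicit.
Unset Printing Implicit Defensive.

Import Order.TTheory GRing.Theory Num.Theory.
Import numFieldNormedType.Exports.

Local Open Scope classical_set_scope.

(** * Dickson's lemma and finite sequences *)

(** The elements of [V] are treated as vectors through their coordinates [f i],
    and only finitely many coordinates are compared, so the induction is on the
    list [r] of coordinates and needs no vector type. For a new coordinate [i],
    take [G0] for the remaining ones and let [T] be the largest value of [f i]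
    on [G0]: vectors with [f i v >= T] are handled by [G0], and the others fall
    into the finitely many slices [f i v = n], [n < T]. *)
Lemma dickson (V : Type) (I : eqType) (f : I -> V -> nat) (r : seq I)
    (P : set V) :
  exists2 G : set V, finite_set G /\ G `<=` P &
    forall v, P v -> exists2 g, G g & forall i, i \in r -> (f i g <= f i v)%N.
Proof.
elim: r P => [|i r IHr] P.
  have [[v Pv]|PN] := pselect (exists v, P v).
    by exists [set v] => [|w _]; [split=> // _ -> | exists v].
  by exists set0 => [|v Pv]; [split | case: PN; exists v].
have [G0 [G0fin G0P] G0dom] := IHr P.
have /finite_seqP[ts tsE] : finite_set (f i @` G0) by exact: finite_image.
pose T := (\max_(t <- ts) t)%N.
have /choice [G GP] : forall n, exists Gn : set V,
    [/\ finite_set Gn, Gn `<=` [set v | P v /\ f i v = n] &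
      forall v, P v -> f i v = n ->
        exists2 g, Gn g & forall j, j \in r -> (f j g <= f j v)%N].
  move=> n; have [Gn [Gnfin GnP] Gndom] := IHr [set v | P v /\ f i v = n].
  by exists Gn; split=> // v Pv fv; exact: Gndom.
exists (G0 `|` \bigcup_(n in `I_T) G n).
  split; first rewrite finite_setU; first split=> //.
    by apply: bigcup_finite => // n _; have [] := GP n.
  by move=> v [/G0P//|[n _]]; have [_ GnP _] := GP n; move=> /GnP[].
move=> v Pv; have [vT|vT] := ltnP (f i v) T.
  have [_ GvP Gvdom] := GP (f i v).
  have [g Gg gv] := Gvdom v Pv erefl; exists g; first by right; exists (f i v).
  by move=> j; rewrite inE => /predU1P[->|/gv//]; have [_ ->] := GvP _ Gg.
have [g Gg gv] := G0dom v Pv; exists g; first by left.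
move=> j; rewrite inE => /predU1P[->|/gv//]; apply: leq_trans vT.
rewrite /T; apply: (@leq_bigmax_seq _ _ xpredT (fun t : nat => t)) => //.
have : (f i @` G0) (f i g) by exists g.
by rewrite tsE.
Qed.

Lemma Posz_inj : injective Posz. Proof. by move=> m n []. Qed.

Lemma seq_argmax (T : eqType) (F : T -> rat) (s : seq T) : s != [::] ->
  exists2 x, x \in s & forall y, y \in s -> (F y <= F x)%R.
Proof.
elim: s => // x s IHs _; have [->|/IHs[z zs zmax]] := eqVneq s [::].
  by exists x; [exact: mem_head | move=> y; rewrite inE => /eqP->].
have [zx|xz] := leP (F z) (F x).
  exists x; first exact: mem_head.
  by move=> y; rewrite inE => /predU1P[->//|/zmax yz]; exact: le_trans zx.
exists z; first by rewrite inE zs orbT.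
by move=> y; rewrite inE => /predU1P[->|/zmax//]; exact: ltW.
Qed.

Lemma count_lt (T : eqType) (a b : pred T) (s : seq T) x :
  (forall y, a y -> b y) -> x \in s -> b x -> ~~ a x ->
  (count a s < count b s)%N.
Proof.
move=> ab xs bx ax; have := perm_to_rem xs => /permP xP.
rewrite !{}xP /= bx (negbTE ax) add0n add1n ltnS.
exact: sub_count.
Qed.

(** Transitivity of comparing the slopes y / x of vectors in the quadrant, with
    vertical vectors allowed. *)
Lemma slope_trans x1 y1 x2 y2 x3 y3 :
  (y1 * x2 < x1 * y2 -> y2 * x3 < x2 * y3 -> y1 * x3 < x1 * y3)%N.
Proof.
move=> lt12 lt23; have x2_gt0 : (0 < x2)%N by case: x2 lt23 {lt12}.
have x1_gt0 : (0 < x1)%N by case: x1 lt12.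
have le12 : (y1 * x2 * x3 <= x1 * y2 * x3)%N.
  by rewrite leq_mul2r (ltnW lt12) orbT.
have {}lt23 : (x1 * (y2 * x3) < x1 * (x2 * y3))%N by rewrite ltn_pmul2l.
by rewrite -(ltn_pmul2l x2_gt0); lia.
Qed.

(** * Units, factorizations and atoms *)

Section Factorizations.

Variable H : monoidType.
Hypothesis HC : mon_commutative H.
Hypothesis HK : mon_cancellative H.

#[local] HB.instance Definition _ := SemiGroup.isCommutativeLaw.Build H *%g HC.

Lemma is_unitE (a : H) : is_unit a <-> exists v, (a * v = 1)%g.
Proof.
by split=> [[_ [v _ av1]]|[v av1]]; [exists v | split=> //; exists v].
Qed.

Lemma is_unit1 : is_unit (1%g : H).
Proof. by apply/is_unitE; exists 1%g; rewrite mulg1. Qed.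

Lemma is_unitM (a b : H) : is_unit (a * b)%g <-> is_unit a /\ is_unit b.
Proof.
split=> [/is_unitE[v abv]|[/is_unitE[v av] /is_unitE[w bw]]].
  split; apply/is_unitE; first by exists (b * v)%g; rewrite mulgA.
  by exists (a * v)%g; rewrite mulgA (HC b).
apply/is_unitE; exists (v * w)%g.
by rewrite -mulgA (mulgA b) (HC b) -mulgA bw mulg1.
Qed.

Lemma monomialM (a b : H) i j i' j' :
  (a ^+ i * b ^+ j * (a ^+ i' * b ^+ j') = a ^+ (i + i') * b ^+ (j + j'))%g.
Proof.
rewrite -mulgA (mulgA (b ^+ j)%g) (HC (b ^+ j)%g) -mulgA -expgnDr.
by rewrite mulgA -expgnDr.
Qed.

Lemma monomialX (a b : H) i j n :
  ((a ^+ i * b ^+ j) ^+ n = a ^+ (i * n) * b ^+ (j * n))%g.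
Proof. by rewrite expgMn ?expgnA//; exact: HC. Qed.

Lemma is_unitX (a : H) n : (0 < n)%N -> is_unit (a ^+ n)%g -> is_unit a.
Proof. by case: n => // n _; rewrite expgS => /is_unitM[]. Qed.

Definition assoc_prod (s : seq H) (h : H) : Prop :=
  exists2 e, is_unit e & h = ((\prod_(u <- s) u) * e)%g.

Lemma assoc_prodM s t g h :
  assoc_prod s g -> assoc_prod t h -> assoc_prod (s ++ t) (g * h)%g.
Proof.
move=> [e eU ->] [d dU ->]; exists (e * d)%g; first exact/is_unitM.
by rewrite big_cat /= -!mulgA; congr (_ * _)%g; rewrite !mulgA (HC e).
Qed.

(** Factorizations into atoms are taken up to a unit, so that units have the
    empty factorization and the cases of units and non-units in the definition
    of [lengths] merge (see [lengthsP]). *)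
Definition factors (s : seq H) (h : H) : Prop :=
  (forall u, u \in s -> atom u) /\ assoc_prod s h.

Lemma factorsM s t g h :
  factors s g -> factors t h -> factors (s ++ t) (g * h)%g.
Proof.
move=> [sA sg] [tA th]; split; last exact: assoc_prodM.
by move=> u; rewrite mem_cat => /orP[/sA|/tA].
Qed.

Lemma factors_perm s t h : perm_eq s t -> factors s h -> factors t h.
Proof.
move=> st [sA [e eU ->]]; split.
  by move=> u; rewrite -(perm_mem st) => /sA.
by exists e => //; rewrite (perm_big _ st).
Qed.

Lemma factors_cancel s t g h :
  factors (s ++ t) (g * h)%g -> factors s g -> factors t h.
Proof.
move=> [stA [e eU ge]] [sA [d dU gd]]; split.
  by move=> u ut; apply: stA; rewrite mem_cat ut orbT.
have /is_unitE [d' dd'] := dU.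
have d'U : is_unit d' by apply/is_unitE; exists d; rewrite HC.
exists (e * d')%g; first exact/is_unitM.
apply: (HK (a := g)); rewrite ge big_cat /= gd -!mulgA; congr (_ * _)%g.
by rewrite (HC d) -!mulgA (HC d') dd' mulg1.
Qed.

Lemma factors_unit s h : is_unit h -> factors s h -> s = [::].
Proof.
case: s => // u s hU [sA [e eU hE]].
move: hU; rewrite hE big_cons -mulgA => /is_unitM[uU _].
by case: (sA u (mem_head _ _)).
Qed.

Lemma lengthsP (h : H) k : lengths h k <-> exists2 s, size s = k & factors s h.
Proof.
split=> [[[hU ->]|[hN [s [sk sA hE]]]]|[s <- sh]].
- exists [::] => //; split=> //; exists h => //.
  by rewrite big_nil mul1g.
- exists s => //; split=> //; exists 1%g; [exact: is_unit1 | by rewrite mulg1].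
- have [hU|hN] := pselect (is_unit h).
    by left; rewrite (factors_unit hU sh).
  right; split=> //; case: sh => sA [e eU hE].
  case: s => [|u s] in sA hE *.
    by case: hN; rewrite hE big_nil mul1g.
  (* The unit is absorbed by the first atom. *)
  exists ((u * e)%g :: s); split=> //.
    move=> v; rewrite inE => /predU1P[->|vs]; last first.
      by apply: sA; rewrite inE vs orbT.
    have [uN uA] := sA u (mem_head _ _); split; first by move=> /is_unitM[].
    have /is_unitE [e' ee'] := eU.
    move=> a b uab; have := uA a (b * e')%g.
    rewrite mulgA -uab -mulgA ee' mulg1 => /(_ erefl)[|/is_unitM[]]; tauto.
  by rewrite hE !big_cons -!mulgA; congr (_ * _)%g; rewrite HC.
Qed.

Lemma lengths1 : lengths (1%g : H) 0%N.
Proof. by left; split=> //; exact: is_unit1. Qed.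

Lemma lengthsM g h k l :
  lengths g k -> lengths h l -> lengths (g * h : H)%g (k + l)%N.
Proof.
move=> /lengthsP[s <- sg] /lengthsP[t <- th]; apply/lengthsP.
by exists (s ++ t); [rewrite size_cat | exact: factorsM].
Qed.

Lemma lengthsX g k n : lengths g k -> lengths (g ^+ n : H)%g (k * n)%N.
Proof.
move=> gk; elim: n => [|n IHn]; first by rewrite muln0; exact: lengths1.
by rewrite expgS mulnS; exact: lengthsM.
Qed.

Lemma lengths_gt0 (h : H) k : ~ is_unit h -> lengths h k -> (0 < k)%N.
Proof.
move=> hN /lengthsP[[|u s] <- //= [_ [e eU hE]]].
by case: hN; rewrite hE big_nil mul1g.
Qed.

Definition spanned (us : seq H) (h : H) : Prop :=
  exists2 s : seq H, {subset s <= us} & assoc_prod s h.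

Lemma spanned_unit us e : is_unit e -> spanned us e.
Proof.
by move=> eU; exists [::] => //; exists e => //; rewrite big_nil mul1g.
Qed.

Lemma spanned_mem us u : u \in us -> spanned us u.
Proof.
move=> uus; exists [:: u] => [v|]; first by rewrite inE => /eqP->.
by exists 1%g; [exact: is_unit1 | rewrite big_seq1 mulg1].
Qed.

Lemma spannedM us g h : spanned us g -> spanned us h -> spanned us (g * h)%g.
Proof.
move=> [s ss sg] [t ts th]; exists (s ++ t); last exact: assoc_prodM.
by move=> u; rewrite mem_cat => /orP[/ss|/ts].
Qed.

Lemma spanned_trans us vs h :
  (forall u, u \in us -> spanned vs u) -> spanned us h -> spanned vs h.
Proof.
move=> uv [s ss [e eU ->]]; apply: spannedM; last exact: spanned_unit.
elim: s ss => [|u s IHs] ss.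
  by rewrite big_nil; exact: spanned_unit is_unit1.
rewrite big_cons; apply: spannedM; first by apply/uv/ss/mem_head.
by apply: IHs => v vs'; apply: ss; rewrite inE vs' orbT.
Qed.

Lemma dvd_prod_mem (u : H) s : u \in s -> mon_dvd u (\prod_(v <- s) v)%g.
Proof.
move=> /perm_to_rem us; rewrite (perm_big _ us) /= big_cons.
by exists (\prod_(v <- rem u s) v)%g.
Qed.

Lemma divisor_closureM (c g h : H) :
  divisor_closure c (g * h)%g -> divisor_closure c g /\ divisor_closure c h.
Proof.
move=> [n n0 [d cE]]; split; exists n => //.
  by exists (h * d)%g; rewrite mulgA.
by exists (g * d)%g; rewrite cE mulgA (HC h).
Qed.

(** Representatives of the finitely many generating cosets generate the divisor
    closure up to units. *)
Lemma lfg_spanned (c : H) : reduced_finitely_generated (divisor_closure c) ->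
  exists2 gs : seq H, (forall g, g \in gs -> divisor_closure c g) &
    forall h, divisor_closure c h -> spanned gs h.
Proof.
set S := divisor_closure c.
move=> [E [/finite_seqP[Es EE] ES gen]].
have /choice [r rP] : forall B, exists g : H, E B -> S g /\ unit_coset S g = B.
  move=> B; have [EB|] := pselect (E B); last by exists 1%g.
  by have [g] := ES _ EB; exists g.
exists (map r Es) => [g /mapP[B BE ->]|h hS].
  by have [] // := rP B; rewrite EE.
have [s sE hs] := gen _ (ex_intro2 _ _ h hS erefl).
suff sP x : (\big[@set_mul H/units S]_(B <- s) B) x -> spanned (map r Es) x.
  apply: sP; rewrite -hs; exists 1%g; last by rewrite mulg1.
  split; last exists 1%g; rewrite ?mulg1 //; exists 1%N => //; exists c;
  by rewrite mul1g.
elim: s sE x {hs} => [|B s IHs] sE x; first by rewrite big_nil => -[_ [v _ xv]];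
  apply/spanned_unit/is_unitE; exists v.
rewrite big_cons => -[y By [z zs <-]]; apply: spannedM; last first.
  by apply: IHs zs => C Cs; apply: sE; rewrite inE Cs orbT.
have EB := sE B (mem_head _ _); have [_ rB] := rP B EB.
move: By; rewrite -rB => -[u [_ [v _ uv]] <-]; apply: spannedM.
  by apply/spanned_mem/map_f; move: EB; rewrite EE.
by apply/spanned_unit/is_unitE; exists v.
Qed.

(** A generating list of minimal size consists of atoms. If a generator u = ab
    did not occur in the expressions of a and b, it would be a product of the
    other generators and could be dropped; if it occurs in the expression of a,
    then cancelling u from u = ab shows that b is a unit. *)
Lemma lfg_atoms (c : H) : reduced_finitely_generated (divisor_closure c) ->
  exists2 us : seq H, (forall u, u \in us -> atom u) &
    forall h, divisor_closure c h -> spanned us h.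
Proof.
move=> /lfg_spanned[gs0 gs0S gs0P].
pose gens (gs : seq H) := (forall g, g \in gs -> divisor_closure c g) /\
  forall h, divisor_closure c h -> spanned gs h.
have exn : exists n, `[< exists2 gs, size gs = n & gens gs >].
  by exists (size gs0); apply/asboolP; exists gs0.
case: (ex_minnP exn) => n /asboolP[us usn [usS usP]] nmin.
exists us => // u uus.
have irr : ~ spanned [seq v <- us | v != u] u.
  move=> uspan; have : (n <= size [seq v <- us | v != u])%N.
    apply: nmin; apply/asboolP; exists [seq v <- us | v != u] => //; split.
      by move=> g; rewrite mem_filter => /andP[_ /usS].
    move=> h /usP; apply: spanned_trans => v vus.
    by have [->//|vu] := eqVneq v u; apply: spanned_mem; rewrite mem_filter vu.
  have := count_predC (fun v => v != u) us.
  have : has (predC (fun v => v != u)) us.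
    by apply/hasP; exists u => //=; rewrite eqxx.
  by rewrite has_count size_filter usn; lia.
split=> [uU|a b uab]; first by apply/irr/spanned_unit.
have [aS bS] : divisor_closure c a /\ divisor_closure c b.
  by apply: divisor_closureM; rewrite -uab; exact: usS.
have split_off g h : (u = g * h)%g -> (exists2 s, u \in s & assoc_prod s g) ->
      is_unit h.
  move=> ugh [s us' [e _ gE]]; have [w sw] := dvd_prod_mem us'.
  have : (u * 1 = u * (w * e * h))%g by rewrite mulg1 {1}ugh gE sw !mulgA.
  move/HK => weh; suff /is_unitM[] : is_unit (w * e * h)%g by [].
  by rewrite -weh; exact: is_unit1.
have [s ss sE] := usP _ aS; have [t ts tE] := usP _ bS.
have [us'|us'] := boolP (u \in s).
  by right; apply: split_off uab _; exists s.
have [ut'|ut'] := boolP (u \in t).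
  by left; apply: (split_off b); [rewrite HC | exists t].
case: irr; rewrite {2}uab; apply: spannedM.
  exists s => // v vs; rewrite mem_filter ss // andbT.
  by apply: contraNneq us' => <-.
exists t => // v vs; rewrite mem_filter ts // andbT.
by apply: contraNneq ut' => <-.
Qed.

End Factorizations.

(** * Finite generation of the monoid of lengths *)

Section Lfg.

Variable H : monoidType.
Hypothesis HC : mon_commutative H.
Hypothesis HK : mon_cancellative H.
Hypothesis HF : locally_finitely_generated H.

Lemma lengths_nonempty (h : H) : exists k, lengths h k.
Proof.
have [us usA usP] := lfg_atoms HC HK (HF h).
have [|s ss hE] := usP h; first by exists 1%N => //; exists 1%g; rewrite mulg1.
by exists (size s); apply/lengthsP => //; exists s => //; split=> // u /ss /usA.
Qed.

(** Every atom dividing a power of [c] is associated to a member of [us], so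
    factorizations can be moved into [us] without changing their length. *)
Lemma factors_within (us : seq H) (c : H) s h :
  (forall u, u \in us -> atom u) ->
  (forall h, divisor_closure c h -> spanned us h) ->
  divisor_closure c h -> factors s h ->
  exists t, [/\ size t = size s, {subset t <= us} & factors t h].
Proof.
move=> usA usP; elim: s h => [|u s IHs] h hc [sA [e eU hE]].
  by exists [::]; split=> //; split=> //; exists e.
have [uc h'c] : divisor_closure c u /\
    divisor_closure c ((\prod_(v <- s) v) * e)%g.
  by apply: (divisor_closureM HC); rewrite mulgA -(big_cons _ _ _ _ xpredT) -hE.
have [|t [tsz tus th]] := IHs _ h'c.
  by split; [move=> v vs; apply: sA; rewrite inE vs orbT | exists e].
have uA := sA u (mem_head _ _).
have [v vus [d dU uE]] :
    exists2 v, v \in us & exists2 d, is_unit d & u = (v * d)%g.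
  have [[|v r] rus [d dU uE]] := usP u uc.
    by case: uA => -[]; rewrite uE big_nil mul1g.
  have vus := rus v (mem_head _ _); exists v => //.
  move: uE; rewrite big_cons -mulgA => uE.
  have [/(proj1 (usA v vus))//|rdU] := (proj2 uA) _ _ uE.
  by exists ((\prod_(w <- r) w) * d)%g.
exists (v :: t); split; first by rewrite /= tsz.
  by move=> w; rewrite inE => /predU1P[->|/tus].
have -> : h = (u * ((\prod_(v <- s) v) * e))%g by rewrite hE big_cons mulgA.
apply: (@factorsM _ HC [:: v]) => //; split.
  by move=> w; rewrite inE => /eqP->; exact: usA.
by exists d => //; rewrite big_seq1.
Qed.

(** The triples (l, i, j) with l a length of a^i b^j form a finitely generated
    monoid. The statement is in the dual form in which it is applied: linear
    inequalities need only be verified on the generators [G]. Generators have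
    (i, j) nonzero because a unit has length 0 only; this makes the splitting
    off of generators terminate. *)
Lemma lengths_cone (a b : H) : exists2 G : seq (nat * nat * nat),
  (forall l i j, (l, i, j) \in G ->
     lengths (a ^+ i * b ^+ j)%g l /\ (0 < i + j)%N) &
  forall x y z : int,
    (forall l i j, (l, i, j) \in G -> 0 <= x * l%:Z + y * i%:Z + z * j%:Z)%R ->
    forall l i j, lengths (a ^+ i * b ^+ j)%g l ->
      (0 <= x * l%:Z + y * i%:Z + z * j%:Z)%R.
Proof.
have [us usA usP] := lfg_atoms HC HK (HF (a * b)%g).
have abc i j : divisor_closure (a * b)%g (a ^+ i * b ^+ j)%g.
  exists (i + j).+1 => //; exists (a ^+ j.+1 * b ^+ i.+1)%g.
  rewrite (monomialM HC) expgMn; last exact: HC.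
  by congr (_ ^+ _ * _ ^+ _)%g; lia.
(* A triple (s, i, j) has as coordinates i, j and the multiplicities of the
   members of [us] in [s]. *)
pose V := (seq H * nat * nat)%type.
pose P : set V := [set v : V | [/\ {subset v.1.1 <= us}, (0 < v.1.2 + v.2)%N &
  factors v.1.1 (a ^+ v.1.2 * b ^+ v.2)%g]].
pose f (c : H + bool) (v : V) := match c with
  | inl u => count_mem u v.1.1 | inr d => if d then v.1.2 else v.2 end.
have [G [Gfin GP] Gdom] :=
  dickson f ([seq inl u | u <- us] ++ [:: inr true; inr false]) P.
have /finite_seqP[Gs GsE] :
    finite_set ((fun v : V => (size v.1.1, v.1.2, v.2)) @` G).
  exact: finite_image.
exists Gs => [l i j lijG|x y z xyzG l i j].
  have : [set` Gs] (l, i, j) by [].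
  rewrite -GsE => -[[[s i'] j'] /GP /= [ss ij0 sF] [<- <- <-]]; split=> //.
  by apply/(lengthsP HC); exists s.
move=> /(lengthsP HC)[s <-].
move=> /(factors_within usA usP (abc i j))[t [<- tus]] {s l}.
have [n ijn] := ubnP (i + j)%N; elim: n => // n IHn in t i j ijn tus *.
have [ij0 tF|ij0 tF] := posnP (i + j)%N.
  have [i0 j0] : i = 0%N /\ j = 0%N by lia.
  rewrite {}i0 {}j0 in tF *.
  by rewrite (factors_unit HC _ tF) ?mulr0 // !expg0 mulg1; exact: is_unit1.
have [[[s i'] j'] Gs' dom] := Gdom (t, i, j) (And3 tus ij0 tF).
have [/= sus i'j'0 sF] := GP _ Gs'.
have i'i : (i' <= i)%N.
  by apply: (dom (inr true)); rewrite mem_cat !inE eqxx orbT.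
have j'j : (j' <= j)%N.
  by apply: (dom (inr false)); rewrite mem_cat !inE eqxx !orbT.
have /count_subseqP[s' s't ss'] : forall u, (count_mem u s <= count_mem u t)%N.
  move=> u; have [us'|us'] := boolP (u \in s); last first.
    by rewrite (count_memPn us').
  apply: (dom (inl u)); rewrite mem_cat; apply/orP; left.
  exact/map_f/sus.
have [r tr] := perm_to_subseq s't.
(* The minimal factorization [s] is split off from [t], leaving [r]. *)
have tsr : perm_eq t (s ++ r).
  by rewrite (perm_trans tr)// perm_cat2r perm_sym.
have rF : factors r (a ^+ (i - i') * b ^+ (j - j'))%g.
  apply: (factors_cancel HC HK _ sF).
  by rewrite (monomialM HC) !subnKC//; exact: (factors_perm HC tsr).
have rus : {subset r <= us}.
  by move=> u ur; apply: tus; rewrite (perm_mem tsr) mem_cat ur orbT.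
have := IHn r (i - i')%N (j - j')%N _ rus rF.
have : (size s, i', j') \in Gs.
  suff : [set` Gs] (size s, i', j') by [].
  by rewrite -GsE; exists (s, i', j').
move=> /xyzG + /(_ _)/wrap[]; first by lia.
rewrite (perm_size tsr) size_cat; move: (size s) (size r) => p q.
rewrite -{2}(subnKC i'i) -{2}(subnKC j'j) !PoszD.
by move: (i - i')%N (j - j')%N => *; nia.
Qed.

End Lfg.

(** * Sharp elements and interpolation of ratios *)

Section Sharp.

Variable H : monoidType.
Hypothesis HC : mon_commutative H.
Hypothesis HK : mon_cancellative H.
Hypothesis HF : locally_finitely_generated H.

(** L(c^n) has maximum M n and minimum m n for every n; this takes the place of
    the rational-valued limits of max L(c^n) / n and min L(c^n) / n. *)
Definition sharp (c : H) (M m : nat) : Prop :=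
  [/\ ~ is_unit c, lengths c M, lengths c m &
      forall n k, lengths (c ^+ n)%g k -> (m * n <= k)%N /\ (k <= M * n)%N].

(** Apply [lengths_cone] with a = b = c, so that a triple (l, i, j) describes a
    length l of c^(i + j). The extreme values of l / (i + j) on the generators
    bound this quotient on all triples, and a common multiple of the two
    exponents i + j at which they occur makes both bounds attained at once. *)
Lemma sharp_power (c : H) : ~ is_unit c ->
  exists N M m, (0 < N)%N /\ sharp (c ^+ N)%g M m.
Proof.
move=> cN; have [G GL Gcone] := lengths_cone HC HK HF c c.
have G0 : G != [::].
  apply/eqP => G0; have [k ck] := lengths_nonempty HC HK HF c.
  have := Gcone 0%R (-1)%R (-1)%R _ k 1%N 0%N; rewrite G0 expg1 expg0 mulg1.
  by move=> /(_ _ ck)/wrap[].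
pose F (g : nat * nat * nat) : rat := (g.1.1%:R / (g.1.2 + g.2)%:R)%R.
have FE l i j l' i' j' : (l, i, j) \in G -> (l', i', j') \in G ->
    (F (l, i, j) <= F (l', i', j'))%R -> (l * (i' + j') <= l' * (i + j))%N.
  move=> /GL[_ ij0] /GL[_ ij'0]; rewrite /F /= ler_pdivrMr ?ltr0n//.
  by rewrite mulrAC ler_pdivlMr ?ltr0n// -!natrM ler_nat.
have [[[l1 i1] j1] g1 max1] := seq_argmax F G0.
have [[[l2 i2] j2] g2 min2] := seq_argmax (fun g => - F g)%R G0.
have [L1 n1] := GL _ _ _ g1; have [L2 n2] := GL _ _ _ g2.
rewrite -expgnDr in L1; rewrite -expgnDr in L2.
exists ((i1 + j1) * (i2 + j2))%N, (l1 * (i2 + j2))%N, (l2 * (i1 + j1))%N.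
split; first by rewrite muln_gt0 n1.
split.
- by apply: contra_not cN; apply: (is_unitX HC); rewrite muln_gt0 n1.
- by rewrite expgnA; exact: lengthsX.
- by rewrite mulnC expgnA; exact: lengthsX.
- move=> n k; rewrite -expgnA -[(c ^+ _)%g]mulg1 -(expg0 c) => ck; split.
    suff : (0 <= (i2 + j2)%:Z * k%:Z
        + - l2%:Z * ((i1 + j1) * (i2 + j2) * n)%N%:Z + - l2%:Z * 0%N%:Z)%R.
      by nia.
    apply: Gcone ck => l i j lijG.
    have := FE _ _ _ _ _ _ g2 lijG; rewrite -lerN2 => /(_ (min2 _ lijG)); nia.
  suff : (0 <= - (i1 + j1)%:Z * k%:Z
      + l1%:Z * ((i1 + j1) * (i2 + j2) * n)%N%:Z + l1%:Z * 0%N%:Z)%R.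
    by nia.
  apply: Gcone ck => l i j lijG.
  have := FE _ _ _ _ _ _ lijG g1 (max1 _ lijG); nia.
Qed.

Section Cone.

Variables a b : H.
Hypothesis aN : ~ is_unit a.
Hypothesis bN : ~ is_unit b.

Local Notation "'d' i j" := (a ^+ i * b ^+ j)%g
  (at level 10, i at level 9, j at level 9).

Lemma monomial_nonunit i j : (0 < i + j)%N -> ~ is_unit (d i j).
Proof.
rewrite addn_gt0 => /orP[i0|j0] /(is_unitM HC)[].
  by move=> /(is_unitX HC i0).
by move=> _ /(is_unitX HC j0).
Qed.

(** A concave function lies below a secant line outside the chord, and a convex
    one above. The hypotheses on p, q and r place the ray of (i1, j1) in the
    cone spanned by (i, j) and (i2, j2), so that lengths of the latter two
    combine to a length of a power of the sharp element d i1 j1. *)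
Lemma sharp_outside i1 j1 M1 m1 i2 j2 M2 m2 l i j p q r :
  sharp (d i1 j1) M1 m1 -> lengths (d i2 j2) M2 -> lengths (d i2 j2) m2 ->
  lengths (d i j) l ->
  (p * i + q * i2 = r * i1)%N -> (p * j + q * j2 = r * j1)%N ->
  (p * l + q * M2 <= r * M1)%N /\ (r * m1 <= p * l + q * m2)%N.
Proof.
move=> [_ _ _ bnd1] LM2 Lm2 Ll iE jE.
have key k : lengths (d i2 j2) k ->
    lengths ((d i1 j1) ^+ r)%g (p * l + q * k)%N.
  move=> Lk; rewrite (monomialX HC) (mulnC i1) (mulnC j1).
  rewrite -iE -jE -(monomialM HC).
  rewrite (mulnC p i) (mulnC p j) (mulnC q i2) (mulnC q j2) -!(monomialX HC).
  rewrite (mulnC p l) (mulnC q k).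
  by apply: (lengthsM HC); apply: (lengthsX HC).
have [_] := bnd1 _ _ (key _ LM2); have [+ _] := bnd1 _ _ (key _ Lm2).
by rewrite (mulnC m1) (mulnC M1).
Qed.

Variable G : seq (nat * nat * nat).
Hypothesis GL : forall l i j, (l, i, j) \in G ->
  lengths (d i j) l /\ (0 < i + j)%N.
Hypothesis Gcone : forall x y z : int,
    (forall l i j, (l, i, j) \in G -> 0 <= x * l%:Z + y * i%:Z + z * j%:Z)%R ->
    forall l i j, lengths (d i j) l -> (0 <= x * l%:Z + y * i%:Z + z * j%:Z)%R.

(** The direction of [g] lies strictly between (i1, j1) and (i2, j2), in
    counterclockwise order. *)
Definition inside i1 j1 i2 j2 (g : nat * nat * nat) : bool :=
  ((j1 * g.1.2 < i1 * g.2) && (g.2 * i2 < g.1.2 * j2))%N.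

(** Let d1 = (i1, j1) and d2 = (i2, j2). Linear interpolation of the values at
    these two boundary rays gives the form
    (i, j) |-> (M1 det((i, j), d2) + M2 det(d1, (i, j))) / det(d1, d2)
    and likewise with m1 and m2. By [sharp_outside] these bound the lengths of
    the generators, hence all lengths, and they are attained on the cone because
    lengths add. *)
Lemma sharp_interior i1 j1 M1 m1 i2 j2 M2 m2 p1 p2 :
  sharp (d i1 j1) M1 m1 -> sharp (d i2 j2) M2 m2 -> (j1 * i2 < i1 * j2)%N ->
  ~~ has (inside i1 j1 i2 j2) G -> (0 < p1)%N ->
  sharp (d (p1 * i1 + p2 * i2)%N (p1 * j1 + p2 * j2)%N)
    (p1 * M1 + p2 * M2)%N (p1 * m1 + p2 * m2)%N.
Proof.
move=> S1 S2 det0 noG p10; have [_ LM1 Lm1 _] := S1; have [_ LM2 Lm2 _] := S2.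
have key k1 k2 : lengths (d i1 j1) k1 -> lengths (d i2 j2) k2 ->
    lengths (d (p1 * i1 + p2 * i2)%N (p1 * j1 + p2 * j2)%N)
      (p1 * k1 + p2 * k2)%N.
  move=> L1 L2; rewrite -(monomialM HC) (mulnC p1 i1) (mulnC p1 j1).
  rewrite (mulnC p2 i2) (mulnC p2 j2) -!(monomialX HC) (mulnC p1) (mulnC p2).
  by apply: (lengthsM HC); apply: (lengthsX HC).
have bound l i j : (l, i, j) \in G ->
    ((i1 * j2 - j1 * i2)%N%:Z * l%:Z <=
      M1%:Z * (i%:Z * j2%:Z - j%:Z * i2%:Z)
        + M2%:Z * (i1%:Z * j%:Z - j1%:Z * i%:Z))%R /\
    ((i1 * j2 - j1 * i2)%N%:Z * l%:Z >=
      m1%:Z * (i%:Z * j2%:Z - j%:Z * i2%:Z)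
        + m2%:Z * (i1%:Z * j%:Z - j1%:Z * i%:Z))%R.
  move=> gG; have [Ll ij0] := GL gG.
  have := hasPn noG _ gG; rewrite /inside /= negb_and -!leqNgt => /orP[le1|le2].
    have le2 : (j * i2 <= i * j2)%N by nia.
    (* Cramer's rule: det(d1, d2) g + det(g, d1) d2 = det(g, d2) d1. *)
    have [] := @sharp_outside _ _ _ _ _ _ _ _ _ _ _
      (i1 * j2 - j1 * i2)%N (j1 * i - i1 * j)%N (i * j2 - j * i2)%N
      S1 LM2 Lm2 Ll.
    - by apply/Posz_inj; rewrite !PoszD !PoszM -!subzn ?(ltnW det0)//; ring.
    - by apply/Posz_inj; rewrite !PoszD !PoszM -!subzn ?(ltnW det0)//; ring.
    - nia.
  have le1 : (j1 * i <= i1 * j)%N by nia.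
  have [] := @sharp_outside _ _ _ _ _ _ _ _ _ _ _
    (i1 * j2 - j1 * i2)%N (j * i2 - i * j2)%N (i1 * j - j1 * i)%N
    S2 LM1 Lm1 Ll.
  - by apply/Posz_inj; rewrite !PoszD !PoszM -!subzn ?(ltnW det0)//; ring.
  - by apply/Posz_inj; rewrite !PoszD !PoszM -!subzn ?(ltnW det0)//; ring.
  - nia.
split; [|exact: key|exact: key|].
  by apply: monomial_nonunit; nia.
move=> n k; rewrite (monomialX HC) => Lk; split.
  have := @Gcone ((i1 * j2 - j1 * i2)%N%:Z)
    (- (m1%:Z * j2%:Z - m2%:Z * j1%:Z))%R
    (- (m2%:Z * i1%:Z - m1%:Z * i2%:Z))%R _ _ _ _ Lk.
  move=> /(_ _)/wrap[]; first by move=> l i j /bound[_]; nia.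
  move=> h; rewrite -(@leq_pmul2l (i1 * j2 - j1 * i2)%N) ?subn_gt0//.
  rewrite -lez_nat -subr_ge0; apply: (le_trans h).
  rewrite le_eqVlt; apply/orP; left; apply/eqP.
  by rewrite !(PoszM, PoszD) -subzn ?(ltnW det0)// !(PoszM, PoszD); ring.
have := @Gcone (- (i1 * j2 - j1 * i2)%N%:Z)%R
  (M1%:Z * j2%:Z - M2%:Z * j1%:Z)%R
  (M2%:Z * i1%:Z - M1%:Z * i2%:Z)%R _ _ _ _ Lk.
move=> /(_ _)/wrap[]; first by move=> l i j /bound[+ _]; nia.
move=> h; rewrite -(@leq_pmul2l (i1 * j2 - j1 * i2)%N) ?subn_gt0//.
rewrite -lez_nat -subr_ge0; apply: (le_trans h).
rewrite le_eqVlt; apply/orP; left; apply/eqP.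
by rewrite !(PoszM, PoszD) -subzn ?(ltnW det0)// !(PoszM, PoszD); ring.
Qed.

(** The hypotheses say M1 / m1 < u / v < M2 / m2. The induction is on the number
    of generators whose direction is strictly inside the cone. *)
Lemma sharp_ratio (u v : nat) i1 j1 M1 m1 i2 j2 M2 m2 :
  sharp (d i1 j1) M1 m1 -> sharp (d i2 j2) M2 m2 -> (j1 * i2 < i1 * j2)%N ->
  (v * M1 < u * m1)%N -> (u * m2 < v * M2)%N ->
  exists c M m, sharp c M m /\ (v * M = u * m)%N.
Proof.
have [n cntn] := ubnP (count (inside i1 j1 i2 j2) G).
elim: n => // n IHn in i1 j1 M1 m1 i2 j2 M2 m2 cntn *.
move=> S1 S2 det0 lt1 lt2.
have [|noG] := boolP (has (inside i1 j1 i2 j2) G); last first.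
  (* The weights make v M - u m, which is linear on the cone, vanish. *)
  pose p1 := (v * M2 - u * m2)%N; pose p2 := (u * m1 - v * M1)%N.
  exists (d (p1 * i1 + p2 * i2)%N (p1 * j1 + p2 * j2)%N).
  exists (p1 * M1 + p2 * M2)%N, (p1 * m1 + p2 * m2)%N; split.
    by apply: sharp_interior => //; rewrite subn_gt0.
  rewrite /p1 /p2; nia.
move=> /hasP[[[l i] j] gG /andP[/= in1 in2]].
have [_ ij0] := GL gG.
(* The generator is no longer strictly inside once its ray, on which a sharp
   element is found at multiple N, bounds the cone. *)
have [N [M [m [N0]]]] := sharp_power (monomial_nonunit ij0).
rewrite (monomialX HC) => S.
have [lt|gt|eq] := ltngtP (v * M)%N (u * m)%N;
  last by exists (d (i * N)%N (j * N)%N), M, m.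
- apply: IHn S S2 _ lt lt2; last by nia.
  rewrite ltnS in cntn; apply: leq_trans cntn; apply: (count_lt _ gG).
  - move=> [[l' i'] j'] /andP[/= h1 h2]; apply/andP; split=> //=.
    by apply: (slope_trans in1); nia.
  - exact/andP.
  - by rewrite /inside /= negb_and -leqNgt; apply/orP; left; nia.
- apply: IHn S1 S _ lt1 gt; last by nia.
  rewrite ltnS in cntn; apply: leq_trans cntn; apply: (count_lt _ gG).
  - move=> [[l' i'] j'] /andP[/= h1 h2]; apply/andP; split=> //=.
    by apply: slope_trans in2; nia.
  - exact/andP.
  - by rewrite /inside /= negb_and -!leqNgt; apply/orP; right; nia.
Qed.

End Cone.
End Sharp.

(** * Elasticities *)

Lemma elasticityE (R : realType) (L : set nat) (M m : nat) :
  (0 < m)%N -> L M -> L m -> (forall k, L k -> (m <= k <= M)%N) ->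
  elasticity R L = (M%:R / m%:R)%R.
Proof.
move=> m0 LM Lm bnd; rewrite /elasticity asboolF; last first.
  by move=> L0; move: Lm m0; rewrite L0 /= => ->.
congr (_%:R / _%:R)%R.
  apply: xget_unique => [|k [Lk kmax]]; first by split=> // k /bnd/andP[].
  by apply/eqP; rewrite eqn_leq kmax// andbT; have /andP[] := bnd _ Lk.
apply: xget_unique => [|k [Lk kmin]]; first by split=> // k /bnd/andP[].
by apply/eqP; rewrite eqn_leq kmin//=; have /andP[] := bnd _ Lk.
Qed.

Section Elasticity.

Variable R : realType.
Variable H : monoidType.
Hypothesis HC : mon_commutative H.
Hypothesis HK : mon_cancellative H.
Hypothesis HF : locally_finitely_generated H.

Lemma elasticity_sharp (c : H) M m : sharp c M m ->
  elasticity R (lengths c) = (M%:R / m%:R)%R.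
Proof.
move=> [cN LM Lm bnd]; apply: elasticityE => //; first exact: lengths_gt0 Lm.
by move=> k Lk; have [] := bnd 1%N k Lk; rewrite !muln1 => -> ->.
Qed.

Lemma lengths_bounds (c : H) N M m n k : sharp (c ^+ N)%g M m ->
  lengths (c ^+ n)%g k -> (m * n <= k * N /\ k * N <= M * n)%N.
Proof.
move=> [_ _ _ bnd] Lk; apply: bnd.
by rewrite expgnAC; apply: (lengthsX HC).
Qed.

(** Writing n = N t + r with r < N, a fixed length l0 of c and the extreme
    lengths M t and m t of c^(N t) give max L(c^n) >= M t + l0 r and
    min L(c^n) <= m t + l0 r, so the elasticity of c^n differs from M / m by
    O(1 / n). The upper bound holds without error term, since
    N max L(c^n) <= M n and N min L(c^n) >= m n. *)
Lemma elasticity_power (c : H) N M m : ~ is_unit c -> (0 < N)%N ->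
  sharp (c ^+ N)%g M m ->
  exists C, forall n, (0 < n)%N ->
    (M%:R / m%:R - C%:R / n%:R <= elasticity R (lengths (c ^+ n)%g)
       <= M%:R / m%:R)%R.
Proof.
move=> cN N0 S; have [cNN LM Lm _] := S; have m0 := lengths_gt0 HC cNN Lm.
have [l0 Ll0] := lengths_nonempty HC HK HF c.
exists (M * l0 * N * N)%N => n n0.
pose L := lengths (c ^+ n)%g.
have cn : ~ is_unit (c ^+ n)%g by move/(is_unitX HC n0).
have exL : exists k, `[< L k >].
  have [k Lk] := lengths_nonempty HC HK HF (c ^+ n)%g.
  by exists k; apply/asboolP.
have ubL k : `[< L k >] -> (k <= M * n)%N.
  move=> /asboolP /(lengths_bounds S)[_ ]; apply: leq_trans; exact: leq_pmulr.
case: (ex_maxnP exL ubL) => x /asboolP Lx xmax.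
case: (ex_minnP exL) => y /asboolP Ly ymin.
have y0 : (0 < y)%N by exact: lengths_gt0 Ly.
rewrite (elasticityE R y0 Lx Ly); last first.
  by move=> k Lk; rewrite xmax ?ymin//; exact/asboolP.
have cE : (c ^+ n = (c ^+ N) ^+ (n %/ N) * c ^+ (n %% N))%g.
  by rewrite -expgnA -expgnDr mulnC -divn_eq.
have upx : (M * (n %/ N) + l0 * (n %% N) <= x)%N.
  apply: xmax; apply/asboolP; rewrite /L cE.
  by apply: (lengthsM HC); exact: lengthsX.
have upy : (y <= m * (n %/ N) + l0 * (n %% N))%N.
  apply: ymin; apply/asboolP; rewrite /L cE.
  by apply: (lengthsM HC); exact: lengthsX.
have rN : (n %% N < N)%N by rewrite ltn_mod.
have [_ xM] := lengths_bounds S Lx; have [ym _] := lengths_bounds S Ly.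
have xy : (m * x <= M * y)%N.
  rewrite -(leq_pmul2r N0); apply: (@leq_trans (m * (M * n))%N).
    by rewrite -mulnA leq_mul2l xM orbT.
  by rewrite mulnCA -mulnA leq_mul2l ym orbT.
have yx : (M * y <= m * x + M * l0 * N)%N.
  move: (n %/ N)%N (n %% N)%N upx upy rN => t r upx upy rN.
  have : (M * y <= M * (m * t + l0 * r))%N by rewrite leq_mul2l upy orbT.
  have : (m * (M * t + l0 * r) <= m * x)%N by rewrite leq_mul2l upx orbT.
  have : (M * l0 * r <= M * l0 * N)%N by rewrite leq_mul2l (ltnW rN) orbT.
  by lia.
have nmy : (n <= m * y * N)%N.
  rewrite -mulnA; apply: leq_trans (leq_pmull _ m0).
  by apply: leq_trans ym; exact: leq_pmull.
have [mR yR nR] : [/\ (0 < m%:R :> R), (0 < y%:R :> R) & (0 < n%:R :> R)]%R.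
  by rewrite !ltr0n.
apply/andP; split; last first.
  by rewrite ler_pdivrMr// mulrAC ler_pdivlMr// -!natrM ler_nat mulnC.
rewrite lerBlDr -lerBlDl.
have -> : (M%:R / m%:R - x%:R / y%:R =
    (M * y)%N%:R / (m * y)%N%:R - (m * x)%N%:R / (m * y)%N%:R :> R)%R.
  by rewrite !natrM; field; rewrite !gt_eqF.
rewrite -mulrBl ler_pdivrMr ?ltr0n ?muln_gt0 ?m0// mulrAC ler_pdivlMr//.
apply: (@le_trans _ _ ((M * l0 * N)%N%:R * n%:R)%R).
  by rewrite ler_wpM2r// lerBlDl -natrD ler_nat.
by rewrite -!natrM ler_nat; nia.
Qed.

Lemma asymptotic_elasticityE (c : H) N M m : ~ is_unit c -> (0 < N)%N ->
  sharp (c ^+ N)%g M m -> asymptotic_elasticity R c = (M%:R / m%:R)%:E.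
Proof.
move=> cN N0 S; have [C CP] := elasticity_power cN N0 S.
have cvgE : (fun n => elasticity R (lengths (c ^+ n)%g)) @ \oo -->
    (M%:R / m%:R : R)%R.
  apply/cvgrPdist_le => e e0; near=> n.
  have n0 : (0 < n)%N by near: n; exact: nbhs_infty_gt.
  have /andP[lo up] := CP n n0; rewrite ger0_norm ?subr_ge0//.
  apply: (@le_trans _ _ (C%:R / n%:R)%R); first by rewrite lerBlDl -lerBlDr.
  rewrite ler_pdivrMr ?ltr0n// mulrC -ler_pdivrMr//.
  by near: n; exact: nbhs_infty_ger.
by rewrite /asymptotic_elasticity EFin_lim ?(cvg_lim _ cvgE).
Unshelve. all: by end_near. Qed.

(** The element with elasticity above [q] need not be sharp, but [q] is also
    exceeded by its asymptotic elasticity. It is not a unit, because asymptotic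
    elasticities are at least 1 and hence q > 1. *)
Lemma sharp_of_ratio (q : rat) :
  (ereal_inf (asymptotic_elasticities R H) < (ratr q)%:E)%E ->
  ((ratr q)%:E < mon_elasticity R H)%E ->
  exists c M m, sharp (c : H) M m /\ ratr q = (M%:R / m%:R : R)%R.
Proof.
move=> /ereal_inf_lt[_ [a aN <-] aq] /ereal_sup_gt[_ [_ [b _ <-] <-] bq].
have [Na [Ma [ma [Na0 Sa]]]] := sharp_power HC HK HF aN.
have [aNN aM am bnda] := Sa; have ma0 := lengths_gt0 HC aNN am.
move: aq; rewrite (asymptotic_elasticityE aN Na0 Sa) lte_fin => aq.
have q1 : (1 < ratr q :> R)%R.
  apply: le_lt_trans aq; rewrite ler_pdivlMr ?ltr0n// mul1r ler_nat.
  by have [+ _] := bnda 1%N _ aM; rewrite muln1.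
have bN : ~ is_unit b.
  move=> bU; move: bq; rewrite lte_fin ltNge => /negP; apply.
  rewrite /elasticity asboolT; first exact: ltW.
  by rewrite eqEsubset; split=> [k [[]//|[]//]|k ->]; left.
have [Nb [Mb [mb [Nb0 Sb]]]] := sharp_power HC HK HF bN.
have [bNN bM bm _] := Sb; have mb0 := lengths_gt0 HC bNN bm.
have {}bq : (ratr q < Mb%:R / mb%:R :> R)%R.
  have [C CP] := elasticity_power bN Nb0 Sb.
  move: bq; rewrite lte_fin => /lt_le_trans; apply.
  by have /andP[] := CP 1%N isT.
pose u := `|numq q|%N; pose v := `|denq q|%N.
have v0 : (0 < v)%N by rewrite absz_gt0 denq_neq0.
have q0 : (0 < q)%R by rewrite -(ltr0q R) (lt_trans _ q1).
have qE : ratr q = (u%:R / v%:R : R)%R.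
  by rewrite /ratr /u /v !pmulrn !gez0_abs ?denq_ge0 ?numq_ge0 ?ltW.
have [c [M [m [S MmE]]]] : exists c M m, sharp (c : H) M m /\ (v * M = u * m)%N.
  have [G GL Gcone] := lengths_cone HC HK HF (a ^+ Na)%g (b ^+ Nb)%g.
  apply: (@sharp_ratio _ HC HK HF _ _ aNN bNN G GL Gcone u v
    1%N 0%N Ma ma 0%N 1%N Mb mb) => //.
  - by rewrite expg1 expg0 mulg1.
  - by rewrite expg1 expg0 mul1g.
  - move: aq; rewrite qE ltr_pdivrMr ?ltr0n// mulrAC ltr_pdivlMr ?ltr0n//.
    by rewrite -!natrM ltr_nat mulnC.
  - move: bq; rewrite qE ltr_pdivrMr ?ltr0n// mulrAC ltr_pdivlMr ?ltr0n//.
    by rewrite -!natrM ltr_nat (mulnC v).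
exists c, M, m; split=> //; rewrite qE.
have [cN _ Lm _] := S; have m0 := lengths_gt0 HC cN Lm.
by apply/eqP; rewrite eqr_div ?pnatr_eq0 -?lt0n// -!natrM eqr_nat -MmE mulnC.
Qed.

End Elasticity.

Theorem theorem1p1 (R : realType) (H : monoidType) :
  mon_commutative H -> mon_cancellative H -> locally_finitely_generated H ->
  asymptotic_fully_elastic R H /\
  (ereal_inf (asymptotic_elasticities R H) = 1%E -> fully_elastic R H).
Proof.
move=> HC HK HF; split=> [q infq qsup|inf1 q q1 qsup].
  have [c [M [m [S qE]]]] := sharp_of_ratio HC HK HF infq qsup.
  have [cN _ _ _] := S; exists c => //.
  by rewrite (asymptotic_elasticityE (N := 1%N) R HC HK HF cN _ S)// qE.
have infq : (ereal_inf (asymptotic_elasticities R H) < (ratr q)%:E)%E.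
  by rewrite inf1 lte_fin -(rmorph1 (@ratr R)) ltr_rat.
have [c [M [m [S qE]]]] := sharp_of_ratio HC HK HF infq qsup.
by exists (lengths c); [exists c | rewrite (elasticity_sharp R HC S)].
Qed.
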